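(* Let $s\ge1$ be an integer, let $G$ be a graph, let $U\subseteq V(G)$, and suppose that $G$ contains no path of order $2s+1$ with both end vertices in $U$. If $f:U\to[0,\infty)$ and $g:V(G)\to[0,\infty)$, then $$\sum_{u\in U}f(u)\sum_{y\sim u}g(y)\le(s-1)\|g\|_\infty\sum_{u\in U}f(u)+s\|f\|_\infty\sum_{y\in V(G)}g(y).$$
   Context: All graphs are finite and simple. The order of a path is its number of vertices. $y\sim u$ means $y$ is adjacent to $u$ in $G$ (so $y$ ranges over all neighbors of $u$ in $V(G)$). For a nonnegative function $f$ on a finite set, $\|f\|_\infty$ is its maximum value (taken to be $0$ on the empty set). *)

(* Defs.v *)
(* Mathematical Components; a finite simple graph is a symmetric irreflexive
   relation on a finType of vertices. *)
From mathcomp Require Import all_boot all_order all_algebra.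

Set Implicit Arguments.
Unset Strict Implicit.
Unset Printing Implicit Defensive.

Import Order.TTheory GRing.Theory Num.Theory.

Local Open Scope ring_scope.

(* The path with successive vertices x :: p; its end vertices are x and
   last x p, and its order k counts vertices. *)
Definition path_of_order (T : finType) (e : rel T) (k : nat) (x : T)
    (p : seq T) : bool :=
  [&& path e x p, uniq (x :: p) & size (x :: p) == k].

(* Only meant for f nonnegative on A: the default 0 then only matters when
   A is empty. *)
Definition supnorm (R : realFieldType) (T : finType) (A : {set T})
    (f : T -> R) : R :=
  \big[Num.max/0]_(x in A) f x.

(* Main.v *)
Require Import Defs.
From mathcomp Require Import all_boot all_order all_algebra.
From mathcomp Require Import zify.

Set Implicit Arguments.
Unset Strict Implicit.
Unset Printing Implicit Defensive.

Import Order.TTheory GRing.Theory Num.Theory.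

(** Both sides of the inequality are linear in [f] and in [g] once the two norms
are fixed, so only the extreme choices of [f] and [g] matter, namely multiples
of indicator functions ([sum_le_supnorm], applied once to [f] and once to [g]).
For the indicators of [A] (inside [U]) and [B], what has to be shown is that the
number of pairs [(u, y)] with [u] in [A], [y] in [B] and [u] adjacent to [y] is at
most [(s - 1) * #|A| + s * #|B|] ([arcs_bound]). With [A = B = U = V(G)] this is
the Erdős–Gallai theorem for paths of order [2s + 1], and the proof follows the
same pattern.

Induct on [#|A| + #|B|]. A vertex of [A] with fewer than [s] neighbours in [B], or
a vertex of [B] with at most [s] neighbours in [A], can be deleted from that set.
Otherwise let [h] be the graph of the edges with one end in [A] and the other in
[B]: every edge of [h] meets [A], a non-isolated vertex of [h] has degree at least
[s], and at least [s + 1] when it lies outside [A]. The heart of the proof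
([small_closed_set]) is that, if [h] has no path of order [2s + 1] with both ends in
[A], then it has a component with an edge and at most [2s] vertices; deleting it
costs at most the allowed amount, by a plain count of pairs ([arcs_small]).

To find the component take a longest path [x_0, x_1, ...] of [h].

- If it has at most [2s + 1] vertices, the degrees of its two ends force the usual
  crossing chords, so the vertices of the path carry a cycle ([crossing_cycle]).
  A cycle with more than [2s] vertices is impossible ([no_long_cycle]), and the
  vertex set of the cycle is a component since the path is longest.

- It cannot have [2s + 2] vertices or more ([no_long_path]). Two vertices of [A]
  at distance [2s] along a path are forbidden, and of two consecutive vertices
  one is in [A]; so in such a path [x_0] is in [A] iff [x_1] is not iff [x_2s] is
  not ([end_phase]). Applied to the paths obtained by rotating at a chord
  [x_0 x_j], this forbids two consecutive neighbours of [x_0]. As all neighbours of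
  [x_0] lie among [x_1, ..., x_(2s-1)], there are at most [s] of them, hence
  exactly [s], they are [x_1, x_3, ..., x_(2s-1)], and [x_0] is in [A]
  ([end_nbrs_odd]). Then [x_1] is outside [A], so it has [s + 1] neighbours, all in
  [A], and wherever the one that is not among [x_0, x_2, ..., x_(2s-2)] lies, it
  completes a forbidden path. *)

(** * Counting a set by means of numerical codes *)

(** The pigeonhole principle in the two directions used below: an upper bound for
the number of neighbours, and the fact that in the case of equality every code
is attained. *)
Lemma card_codes (T : finType) (N : {set T}) (f : T -> nat) n :
  (forall z, z \in N -> f z < n) -> {in N &, injective f} ->
  #|N| <= n /\ (n <= #|N| -> forall k, k < n -> exists2 z, z \in N & f z = k).
Proof.
case: n => [|n] ltf injf.
  split=> //; rewrite leqn0 cards_eq0; apply/eqP/setP=> z; rewrite inE.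
  by apply/negP=> /ltf.
pose F z : 'I_n.+1 := inord (f z).
have injF : {in N &, injective F}.
  by move=> y z Ny Nz /(congr1 val); rewrite /= !inordK ?ltf //; apply: injf.
have cN := card_in_imset injF.
split; first by rewrite -cN (leq_trans (max_card _)) ?card_ord.
rewrite -cN => le_n k lt_k.
have /imsetP[z Nz /(congr1 val)] : inord k \in F @: N.
  suff -> : F @: N = setT by rewrite inE.
  by apply/eqP; rewrite eqEcard subsetT cardsT card_ord.
by rewrite /= !inordK ?ltf //; exists z.
Qed.

(** * Paths and cycles in a graph whose edges all meet a set *)

Section Cover.
Variables (T : finType) (h : rel T) (A : {set T}) (s : nat).
Hypothesis h_sym : symmetric h.
Hypothesis h_irr : irreflexive h.
Hypothesis h_cover : forall x y, h x y -> (x \in A) || (y \in A).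

(** Unlike [path_of_order], this admits the empty sequence and leaves the order
open, so that it is stable under [take] and [drop]. *)
Definition simple_path (q : seq T) : bool := sorted h q && uniq q.

Hypothesis noApath : forall x0 q, simple_path q -> size q = s.*2.+1 ->
  nth x0 q 0 \in A -> nth x0 q s.*2 \in A -> False.

Lemma sorted_cat x0 q1 q2 :
  sorted h (q1 ++ q2) = [&& sorted h q1, sorted h q2 &
    [|| nilp q1, nilp q2 | h (last x0 q1) (head x0 q2)]].
Proof.
case: q1 => [|x q1] /=; first by rewrite andbT.
case: q2 => [|y q2] /=; first by rewrite cats0 andbT.
by rewrite cat_path /= [path h y q2 && _]andbC.
Qed.

Lemma rev_simple_path q : simple_path (rev q) = simple_path q.
Proof.
rewrite /simple_path rev_sorted rev_uniq; congr (_ && _).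
by apply: eq_sorted => x y; rewrite h_sym.
Qed.

Lemma subpath_simple q i n : simple_path q -> simple_path (take n (drop i q)).
Proof.
case/andP=> hq uq; rewrite /simple_path take_sorted ?drop_sorted //=.
by rewrite take_uniq ?drop_uniq.
Qed.

Lemma simple_path_edge x0 q i :
  simple_path q -> i.+1 < size q -> h (nth x0 q i) (nth x0 q i.+1).
Proof. by case/andP=> /sortedP hq _; apply: hq. Qed.

Lemma no_Apair x0 q i : simple_path q -> i + s.*2 < size q ->
  nth x0 q i \in A -> nth x0 q (i + s.*2) \in A -> False.
Proof.
move=> pq lt_i Ai Aj; apply: (@noApath x0 (take s.*2.+1 (drop i q))).
- exact: subpath_simple.
- by rewrite size_take size_drop; case: ltnP => //; lia.
- by rewrite nth_take // nth_drop addn0.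
- by rewrite nth_take // nth_drop.
Qed.

Lemma cycle_simple_path r i : cycle h r -> uniq r -> simple_path (rot i r).
Proof.
rewrite -(rot_cycle i) -(rot_uniq i) /simple_path => cr ->; rewrite andbT.
by case: (rot i r) cr => //= x p; rewrite rcons_path => /andP[].
Qed.

Lemma nth_rot (x0 : T) n r i : i < size r ->
  nth x0 (rot (n %% size r) r) i = nth x0 r ((n + i) %% size r).
Proof.
move=> lt_i; rewrite -modnDml /rot nth_cat size_drop nth_drop.
have: n %% size r < size r by rewrite ltn_mod; lia.
move: (n %% size r) => {}n lt_n.
case: ltnP => lt_ni; first by rewrite modn_small //; lia.
rewrite nth_take; last lia.
rewrite (_ : n + i = (i - (size r - n)) + size r); last lia.
by rewrite modnDr modn_small //; lia.
Qed.

(** Along a cycle [r] with more than [2s] vertices, index the vertices cyclically: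
[i] and [i + 2s] are never both in [A], and one of [i], [i + 1] always is. Hence
membership in [A] strictly alternates, so it has period 2, so [i] and [i + 2s]
agree, and neither can be in [A]: contradiction. *)
Lemma no_long_cycle r : 0 < s -> cycle h r -> uniq r -> s.*2 < size r -> False.
Proof.
move=> s_gt0 cr ur lt_s.
have [x0 _] : exists x0 : T, true by case: (r) lt_s => // x; exists x.
pose a i := nth x0 r (i %% size r) \in A.
have aE i j : j < size r -> (nth x0 (rot (i %% size r) r) j \in A) = a (i + j).
  by move=> lt_j; rewrite nth_rot.
have prot i : simple_path (rot (i %% size r) r) by exact: cycle_simple_path.
have far i : ~~ (a i && a (i + s.*2)).
  apply/negP=> /andP[ai aj].
  apply: (@no_Apair x0 (rot (i %% size r) r) 0) => //.
  - by rewrite size_rot.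
  - by rewrite aE ?addn0 //; lia.
  - by rewrite aE.
have near i : a i || a i.+1.
  have := simple_path_edge x0 (i := 0) (prot i).
  by rewrite size_rot => /(_ ltac:(lia)) /h_cover; rewrite !aE ?addn0 ?addn1 //; lia.
have alt i : a i.+1 = ~~ a i.
  move: (near i) (far i) (near (i + s.*2)) (far i.+1); rewrite addSn.
  by case: (a i) (a i.+1) (a (i + s.*2)) (a (i + s.*2).+1) => [] [] [] [].
have per i : a (i + s.*2) = a i.
  elim: (s) i => [|n IHn] i; first by rewrite addn0.
  by rewrite doubleS !addnS !alt negbK IHn.
by move: (far 0) (far 1); rewrite !per !andbb alt; case: (a 0).
Qed.

(** The four vertices of index [0], [1], [2s], [2s + 1] form two edges, each with an
end in [A], and two pairs at distance [2s], each with an end outside [A]; only two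
patterns remain. *)
Lemma end_phase x0 q : simple_path q -> s.*2.+1 < size q ->
  (nth x0 q 1 \in A) = (nth x0 q 0 \notin A) /\
  (nth x0 q s.*2 \in A) = (nth x0 q 0 \notin A).
Proof.
move=> pq lt_s.
have edge i : i.+1 < size q -> (nth x0 q i \in A) || (nth x0 q i.+1 \in A).
  by move=> lt_i; apply/h_cover/simple_path_edge.
have := edge 0 ltac:(lia); have := edge s.*2 lt_s.
have := @no_Apair x0 q 0 pq ltac:(lia); have := @no_Apair x0 q 1 pq ltac:(lia).
rewrite add0n add1n.
case: (nth _ _ 0 \in A); case: (nth _ _ 1 \in A); case: (nth _ _ s.*2 \in A);
  case: (nth _ _ s.*2.+1 \in A) => //= H1 H2 _ _; split=> //;
  by [case: H1 | case: H2].
Qed.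

(** Pósa rotation: a chord from the first vertex to [x_j] turns the path into
[x_(j-1), ..., x_0, x_j, ...], whose vertices from index [j] on are unchanged. *)
Lemma rotate_simple_path x0 q j : simple_path q -> 0 < j < size q ->
  h (nth x0 q 0) (nth x0 q j) -> simple_path (rev (take j q) ++ drop j q).
Proof.
move=> /andP[hq uq] /andP[j_gt0 lt_j] h0j; rewrite /simple_path.
have -> : uniq (rev (take j q) ++ drop j q) = uniq q.
  rewrite -[in RHS](cat_take_drop j q); apply: perm_uniq.
  by rewrite perm_cat2r perm_rev.
rewrite uq andbT (sorted_cat x0).
move: hq; rewrite -{1}(cat_take_drop j q) (sorted_cat x0) => /and3P[hq1 hq2 _].
have /andP[-> _] : simple_path (rev (take j q)).
  by rewrite rev_simple_path /simple_path hq1 take_uniq.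
rewrite hq2 /=; apply/or3P; apply: Or33.
rewrite -nth_last -nth0 nth_drop addn0 size_rev nth_rev ?size_take ?lt_j; last lia.
by rewrite prednK // subnn nth_take.
Qed.

Lemma rotate_nth (x0 : T) q j i : 0 < j < size q ->
  nth x0 (rev (take j q) ++ drop j q) i = nth x0 q (if i < j then j - i.+1 else i).
Proof.
move=> /andP[j_gt0 lt_j]; rewrite nth_cat size_rev size_take lt_j.
case: ltnP => [lt_i|le_i].
  by rewrite nth_rev ?size_take ?lt_j // nth_take //; lia.
by rewrite nth_drop; congr nth; lia.
Qed.

Lemma cycle_of_path x0 q :
  sorted h q -> h (last x0 q) (head x0 q) -> cycle h q.
Proof. by case: q => //= x q hq hx; rewrite rcons_path hq. Qed.

Hypothesis s_gt0 : 0 < s.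
Hypothesis h_deg : forall x y, h x y -> s + (x \notin A) <= #|[set z | h x z]|.

(** The chord closes a cycle on the first [j + 1] vertices, and cycles are short. *)
Lemma end_cycle x0 q j : simple_path q -> j < size q ->
  h (nth x0 q 0) (nth x0 q j) -> cycle h (take j.+1 q) /\ j < s.*2.
Proof.
move=> /andP[hq uq] lt_j hj.
have cj : cycle h (take j.+1 q).
  apply: (@cycle_of_path x0); first exact: take_sorted.
  by rewrite -nth_last -nth0 size_takel // !nth_take //= h_sym.
split=> //; rewrite ltnNge; apply/negP => le_s.
by apply: (no_long_cycle s_gt0 cj); rewrite ?take_uniq ?size_takel.
Qed.

(** The path rotated at [x_j] starts with [x_(j-1)], [x_(j-2)] and has the same
vertex of index [2s], because [j < 2s]; comparing [end_phase] for both paths through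
that common vertex gives the claim. *)
Lemma end_nbr x0 q j : simple_path q -> s.*2.+1 < size q -> j < size q ->
    h (nth x0 q 0) (nth x0 q j) ->
  [/\ 0 < j, (nth x0 q j.-1 \in A) = (nth x0 q 0 \in A)
    & 1 < j -> (nth x0 q j.-2 \in A) = (nth x0 q 0 \notin A)].
Proof.
move=> pq lt_s lt_j hj; have [_ lt_j2s] := end_cycle pq lt_j hj.
have j_gt0 : 0 < j by case: (j) hj => //; rewrite h_irr.
have [_ phase2s] := end_phase x0 pq lt_s.
have j_bnd : 0 < j < size q by rewrite j_gt0.
have := end_phase x0 (rotate_simple_path pq j_bnd hj).
rewrite size_cat size_rev -size_cat cat_take_drop.
rewrite !rotate_nth // j_gt0 subn1 subn2 => /(_ lt_s).
rewrite (ltnNge s.*2 j) (ltnW lt_j2s) /= phase2s => -[eq1 eq2].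
have eq0 : (nth x0 q j.-1 \in A) = (nth x0 q 0 \in A) by apply: negb_inj.
by split=> // j_gt1; rewrite j_gt1 in eq1; rewrite eq1 eq0.
Qed.

(** The rotations at [x_j] and at [x_(j+1)] would make contradictory claims about
[x_(j-1)]. *)
Lemma end_nbrs_apart x0 q j : simple_path q -> s.*2.+1 < size q -> j.+1 < size q ->
  h (nth x0 q 0) (nth x0 q j) -> h (nth x0 q 0) (nth x0 q j.+1) -> False.
Proof.
move=> pq lt_s lt_j hj hj1.
have [j_gt0 eqj _] := end_nbr pq lt_s (ltnW lt_j) hj.
have [_ _ /=] := end_nbr pq lt_s lt_j hj1.
by rewrite ltnS eqj => /(_ j_gt0); case: (_ \in A).
Qed.

(** The neighbours of [x_0] have index in [1, 2s - 1], and the [s] slots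
[{1, 2}, {3, 4}, ..., {2s - 1, 2s}] contain at most one each. The degree condition
forces one in each slot. The last slot must use [2s - 1], and since consecutive
indices are excluded, every slot must use its odd index. *)
Lemma end_nbrs_odd x0 q : simple_path q -> s.*2.+1 < size q ->
    (forall y, h (nth x0 q 0) y -> y \in q) ->
  nth x0 q 0 \in A /\ forall k, k < s -> h (nth x0 q 0) (nth x0 q k.*2.+1).
Proof.
move=> pq lt_s maxq; set x := nth x0 q.
have nbrP z : h (x 0) z ->
  exists j, [/\ index z q = j, z = x j, 0 < j < s.*2 & h (x 0) (x j)].
  move=> hz; have lt_z : index z q < size q by rewrite index_mem maxq.
  have xz : x (index z q) = z by rewrite /x nth_index // maxq.
  have hxz : h (x 0) (x (index z q)) by rewrite xz.
  have [_ lt2] := end_cycle pq lt_z hxz.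
  have [gt0 _ _] := end_nbr pq lt_s lt_z hxz.
  by exists (index z q); rewrite gt0 lt2.
have lt_q j : j <= s.*2 -> j < size q.
  by move=> le_j; apply: leq_ltn_trans le_j (ltnW lt_s).
(* The slot of a neighbour; indices start at 1, whence the predecessor. *)
pose code z := (index z q).-1./2.
have [||le_deg pairs] := @card_codes T [set z | h (x 0) z] code s.
- move=> z; rewrite inE => /nbrP[j [ej _ j_bnd _]].
  by rewrite /code ej; move: j_bnd; clear; lia.
- move=> y z; rewrite !inE /code => /nbrP[i [-> -> i_bnd hi]] /nbrP[j [-> -> j_bnd hj]].
  move=> eq_code; congr x.
  have [//|[eij|eji]] : i = j \/ (i = j.+1 \/ j = i.+1).
  + by move: i_bnd j_bnd eq_code; clear; lia.
  + case: (@end_nbrs_apart x0 q j); rewrite // -eij // lt_q //.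
    by case/andP: i_bnd => _ /ltnW.
  + case: (@end_nbrs_apart x0 q i); rewrite // -eji // lt_q //.
    by case/andP: j_bnd => _ /ltnW.
have deg0 : s + (x 0 \notin A) <= s.
  apply: leq_trans le_deg; apply/h_deg/(simple_path_edge x0 pq)/lt_q.
  by rewrite double_gt0.
have A0 : x 0 \in A.
  by move: deg0; case: (x 0 \in A) => //=; rewrite addn1 ltnn.
split=> // k lt_k.
have pair i : i < s -> h (x 0) (x i.*2.+1) \/ h (x 0) (x i.*2.+2).
  move=> lt_i; have [|z] := pairs _ i lt_i.
    apply: leq_trans (h_deg (simple_path_edge x0 pq _)); first by rewrite leq_addr.
    by apply: lt_q; rewrite double_gt0.
  rewrite inE /code => /nbrP[j [-> _ j_bnd hj]] eqj; move: hj.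
  have [->|->] : j = i.*2.+1 \/ j = i.*2.+2 by move: j_bnd eqj; clear; lia.
  - by left.
  - by right.
(* Descend from the last slot; [d] is the number of slots after the [k]-th. *)
have [d eqd] : exists d, k + d.+1 = s by exists (s - k.+1); rewrite addnS -addSn subnKC.
elim: d k eqd lt_k => [|d IHd] k eqd lt_k; case: (pair k lt_k) => // hk2; exfalso.
- have eqs : k.*2.+2 = s.*2 by rewrite -doubleS -eqd addn1.
  have [|_] := end_cycle pq _ hk2; first by rewrite lt_q ?eqs.
  by rewrite eqs ltnn.
- have lt_k1 : k.+1 < s by rewrite -eqd; clear; lia.
  apply: (end_nbrs_apart pq lt_s _ hk2 (IHd k.+1 _ lt_k1)); last by rewrite addSnnS.
  by apply: lt_q; move: lt_k1; clear; lia.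
Qed.

(** If [z] were off the cycle, the path that goes from [z] to [r_1] and then all the
way round the cycle, backwards, down to [r_2], would have order [2s + 1]; its ends
[z] and [r_2] are neighbours of [r_1], which is outside [A], so they are in [A]. *)
Lemma cycle_nbr_mem x0 r z : cycle h r -> uniq r -> size r = s.*2 -> 1 < s ->
  nth x0 r 1 \notin A -> h (nth x0 r 1) z -> z \in r.
Proof.
move=> cr ur sr s_gt1 A1 hz; apply/negPn/negP => zr.
have gt2 : 2 < s.*2 by move: s_gt1; clear; lia.
have A1N y : h (nth x0 r 1) y -> y \in A by move/h_cover; rewrite (negbTE A1).
have rot2 i : i < s.*2 -> nth x0 (rot 2 r) i = nth x0 r ((2 + i) %% s.*2).
  by move=> lt_i; rewrite -[in LHS](@modn_small 2 (size r)) ?sr // -sr nth_rot ?sr.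
have p2 : simple_path (rev (rot 2 r)).
  by rewrite rev_simple_path cycle_simple_path.
have szr : size (rev (rot 2 r)) = s.*2 by rewrite size_rev size_rot.
have end1 : nth x0 (rev (rot 2 r)) 0 = nth x0 r 1.
  rewrite nth_rev size_rot sr ?double_gt0 // rot2; last first.
    by rewrite subn1 prednK ?double_gt0.
  rewrite (_ : 2 + (s.*2 - 1) = 1 + s.*2) ?modnDr ?modn_small //;
  by move: gt2; clear; lia.
have end2 : nth x0 (rev (rot 2 r)) s.*2.-1 = nth x0 r 2.
  rewrite nth_rev size_rot sr prednK ?double_gt0 // subnn rot2 ?double_gt0 //.
  by rewrite addn0 modn_small.
apply: (@noApath x0 (z :: rev (rot 2 r))); first last.
- rewrite -[s.*2]prednK ?double_gt0 //= end2; apply: A1N.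
  have := simple_path_edge x0 (i := 1) (cycle_simple_path 0 cr ur).
  by rewrite rot0 sr; apply.
- exact: A1N.
- by rewrite /= szr.
case/andP: p2 => s2 u2.
rewrite /simple_path cons_uniq mem_rev mem_rot zr u2 andbT.
rewrite -cat1s (sorted_cat x0 [:: z]) s2 /= -nth0 end1 h_sym hz.
by rewrite !orbT.
Qed.

(** A longest path, or any path that cannot be prolonged at its first vertex, has at
most [2s + 1] vertices. By [end_nbrs_odd] the vertices [x_0, ..., x_(2s-1)] form a
cycle, in which [x_0, x_2, ..., x_(2s-2)] and [x_(2s-1)] are in [A] while
[x_1, x_3, ..., x_(2s-3)] are not. The vertex [x_1] has [s + 1] neighbours, all in
[A] and, by [cycle_nbr_mem], all on this cycle. The only one that does not have an
even index is therefore [x_(2s-1)], and the chord [x_1 x_(2s-1)] creates the path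
[x_(2s+1), x_(2s), x_(2s-1), x_1, x_2, ..., x_(2s-2)], which is forbidden. *)
Lemma no_long_path x0 q : simple_path q -> s.*2.+1 < size q ->
  (forall y, h (nth x0 q 0) y -> y \in q) -> False.
Proof.
move=> pq lt_s maxq; have [hq uq] := andP pq.
have [phase1 phase2s] := end_phase x0 pq lt_s.
have [A0 odds] := end_nbrs_odd pq lt_s maxq.
set x := nth x0 q in phase1 phase2s A0 odds.
rewrite A0 /= in phase1 phase2s.
have edge i : i.+1 < size q -> h (x i) (x i.+1) by exact: simple_path_edge.
have cover i : i.+1 < size q -> (x i \in A) || (x i.+1 \in A).
  by move=> lt_i; apply/h_cover/edge.
have lt_q j : j <= s.*2 -> j < size q.
  by move=> le_j; apply: leq_ltn_trans le_j (ltnW lt_s).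
have s2K : s.*2.-1.+1 = s.*2 by rewrite prednK ?double_gt0.
have A2s1 : x s.*2.-1 \in A.
  by have := cover s.*2.-1; rewrite s2K phase2s orbF => ->; rewrite ?lt_q.
have A2sS : x s.*2.+1 \in A by have := cover s.*2 lt_s; rewrite phase2s.
(* For [s = 1] the vertices [x_1] and [x_(2s-1)] would coincide. *)
have s_gt1 : 1 < s.
  by move: s_gt0 A2s1 phase1; case: (s) => [|[|n]] //= _ ->.
have lt2s1 : s.*2.-1 < size q by rewrite lt_q // leq_pred.
have h2s1 : h (x 0) (x s.*2.-1).
  have := odds s.-1; rewrite ltn_predL s_gt0 => /(_ isT).
  by rewrite (_ : s.-1.*2.+1 = s.*2.-1) //; move: s_gt0; clear; lia.
have [c2s1 _] := end_cycle pq lt2s1 h2s1; rewrite s2K in c2s1.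
have [_ A2s2 _] := end_nbr pq lt_s lt2s1 h2s1.
have A1 z : h (x 1) z -> z \in A by move=> /h_cover; rewrite phase1.
have nbr1 z : h (x 1) z -> exists j, [/\ index z q = j, z = x j, j < s.*2 & ~~ odd j].
  move=> hz; have Az := A1 z hz; exists (index z q).
  have zC : z \in take s.*2 q.
    apply: (cycle_nbr_mem (x0 := x0) c2s1) => //.
    - exact: take_uniq.
    - by rewrite size_takel // ltnW // lt_q.
    - by rewrite nth_take ?phase1 //; move: s_gt1; clear; lia.
    - by rewrite nth_take //; move: s_gt1; clear; lia.
  have lt_z : index z q < s.*2.
    rewrite -[X in index z X](cat_take_drop s.*2 q) index_cat zC.
    by rewrite -[X in _ < X](@size_takel s.*2 _ q) ?index_mem // ltnW // lt_q.
  have xz : z = x (index z q) by rewrite /x nth_index // (mem_take zC).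
  split=> //; apply/negP=> odd_z.
  (* If the odd index [j] of [z] is less than [2s - 1], then [x_(j+2)] is a
     neighbour of [x_0], which puts [x_j] outside [A]. *)
  have [lt_z2|le_z2] := ltnP (index z q).+2 s.*2.
    have hz2 : h (x 0) (x (index z q).+2).
      rewrite (_ : (index z q).+2 = (index z q).+2./2.*2.+1); last first.
        by move: odd_z; clear; lia.
      by apply: odds; move: lt_z2 odd_z; clear; lia.
    have [_ _ /(_ isT)] := end_nbr pq lt_s (lt_q _ (ltnW lt_z2)) hz2.
    by rewrite A0 /= -/x -xz Az.
  have eq_z : z = x s.*2.-1 by rewrite xz; congr x; move: lt_z le_z2 odd_z; clear; lia.
  (* With [z = x_(2s-1)], the forbidden path is [rev E ++ D]. *)
  pose E := take 3 (drop s.*2.-1 q).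
  pose D := take s.*2.-2 (drop 1 q).
  have szE : size E = 3.
    by rewrite size_takel // size_drop; move: lt_s s_gt1; clear; lia.
  have szD : size D = s.*2.-2.
    by rewrite size_takel // size_drop; move: lt_s s_gt1; clear; lia.
  have nE i : i < 3 -> nth x0 E i = x (s.*2.-1 + i).
    by move=> lt_i; rewrite nth_take // nth_drop.
  have nD i : i < s.*2.-2 -> nth x0 D i = x i.+1.
    by move=> lt_i; rewrite nth_take // nth_drop.
  apply: (@noApath x0 (rev E ++ D)).
  - rewrite /simple_path; apply/andP; split; last first.
      rewrite (perm_uniq (s2 := E ++ D)) ?perm_cat2r ?perm_rev // uniq_catC.
      rewrite (_ : D ++ E = take (s.*2.-2 + 3) (drop 1 q)) ?take_uniq ?drop_uniq //.
      rewrite takeD drop_drop /E; congr (_ ++ take _ (drop _ _)).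
      by move: s_gt1; clear; lia.
    have /andP[sE _] : simple_path (rev E) by rewrite rev_simple_path subpath_simple.
    have /andP[sD _] := subpath_simple 1 s.*2.-2 pq.
    rewrite (sorted_cat x0) sE sD -nth_last -nth0 size_rev szE.
    have -> : nth x0 (rev E) 3.-1 = z.
      by rewrite nth_rev szE // nE // subnn addn0 eq_z.
    rewrite nD; last by move: s_gt1; clear; lia.
    by rewrite h_sym hz !orbT.
  - by rewrite size_cat size_rev szE szD; move: s_gt1; clear; lia.
  - rewrite nth_cat size_rev szE nth_rev szE // nE //.
    by rewrite (_ : _ + _ = s.*2.+1) //; move: s_gt1; clear; lia.
  - rewrite nth_cat size_rev szE ifN; last by move: s_gt1; clear; lia.
    rewrite nD; last by move: s_gt1; clear; lia.
    rewrite (_ : (s.*2 - 3).+1 = s.*2.-2); last by move: s_gt1; clear; lia.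
    by rewrite A2s2.
have [||le_deg _] := @card_codes T [set z | h (x 1) z] (fun z => (index z q)./2) s.
- move=> z; rewrite inE => /nbr1[j [-> _ lt_j _]].
  by move: lt_j; clear; lia.
- move=> y z; rewrite !inE => /nbr1[i [-> -> _ ei]] /nbr1[j [-> -> _ ej]] eq_code.
  by congr x; move: ei ej eq_code; clear; lia.
have h10 : h (x 1) (x 0) by rewrite h_sym edge // lt_q // double_gt0.
by have := leq_trans (h_deg h10) le_deg; rewrite phase1 addn1 ltnn.
Qed.

(** The order of a simple path is at most [#|T|], so a maximum exists. *)
Lemma ex_longest_path : exists q, simple_path q /\
  forall q', simple_path q' -> size q' <= size q.
Proof.
pose P n := [exists t : n.-tuple T, simple_path t].
have exP : exists n, P n by exists 0; apply/existsP; exists [tuple].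
have boundP n : P n -> n <= #|T|.
  case/existsP=> t /andP[_ ut].
  by rewrite -(size_tuple t) -(card_uniqP ut) max_card.
case: (ex_maxnP exP boundP) => n /existsP[t pt] maxn.
exists t; split=> // q pq; rewrite size_tuple; apply: maxn.
by apply/existsP; exists (in_tuple q).
Qed.

(** The classical crossing argument: among the [n] edges of the path, those whose
right end is a neighbour of the first vertex and those whose left end is a
neighbour of the last one must overlap, and an edge [x_i x_(i+1)] in both classes
gives the cycle [x_0, ..., x_i, x_n, ..., x_(i+1)]. *)
Lemma crossing_cycle x0 q n : simple_path q -> size q = n.+1 ->
    (forall y, h (nth x0 q 0) y -> y \in q) ->
    (forall y, h (nth x0 q n) y -> y \in q) ->
    n < #|[set z | h (nth x0 q 0) z]| + #|[set z | h (nth x0 q n) z]| ->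
  exists2 r, cycle h r & perm_eq r q.
Proof.
move=> pq sq; set x := nth x0 q => max0 maxn lt_n.
have [hq uq] := andP pq.
pose S0 := [set i : 'I_n | h (x 0) (x i.+1)].
pose Sn := [set i : 'I_n | h (x n) (x i)].
have le0 : #|[set z | h (x 0) z]| <= #|S0|.
  apply: leq_trans (leq_imset_card (fun i : 'I_n => x i.+1) _).
  apply/subset_leq_card/subsetP => z; rewrite inE => hz; have zq := max0 z hz.
  have lt_z : index z q < n.+1 by rewrite -sq index_mem.
  have xz : x (index z q) = z by rewrite /x nth_index.
  case: (index z q) lt_z xz => [_ x0z|i lt_i xz].
    by rewrite -x0z h_irr in hz.
  by apply/imsetP; exists (Ordinal (lt_i : i < n)); rewrite ?inE /= xz.
have len : #|[set z | h (x n) z]| <= #|Sn|.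
  apply: leq_trans (leq_imset_card (fun i : 'I_n => x i) _).
  apply/subset_leq_card/subsetP => z; rewrite inE => hz; have zq := maxn z hz.
  have lt_z : index z q < n.+1 by rewrite -sq index_mem.
  have xz : x (index z q) = z by rewrite /x nth_index.
  have lt_zn : index z q < n.
    rewrite ltn_neqAle -ltnS lt_z andbT; apply: contraTneq hz => eq_n.
    by rewrite -xz eq_n h_irr.
  by apply/imsetP; exists (Ordinal lt_zn); rewrite ?inE /= xz.
have /set0Pn[i] : S0 :&: Sn != set0.
  rewrite -cards_eq0 -lt0n -(ltn_add2l #|S0 :|: Sn|) addn0 cardsUI.
  apply: leq_ltn_trans (max_card _) _; rewrite card_ord.
  by apply: leq_trans lt_n _; apply: leq_add.
rewrite !inE => /andP[h0 hn]; have lt_i := ltn_ord i.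
exists (take i.+1 q ++ rev (drop i.+1 q)); last first.
  by rewrite -[X in perm_eq _ X](cat_take_drop i.+1 q) perm_cat2l perm_rev.
have sz1 : size (take i.+1 q) = i.+1 by rewrite size_takel // sq ltnW.
have sz2 : size (drop i.+1 q) = n - i by rewrite size_drop sq subSS.
have le_n1 : (n - i).-1 < n - i by rewrite ltn_predL subn_gt0.
have /andP[s1 _] : simple_path (take i.+1 q).
  by have := subpath_simple 0 i.+1 pq; rewrite drop0.
have /andP[s2 _] : simple_path (rev (drop i.+1 q)).
  by rewrite rev_simple_path /simple_path drop_sorted ?drop_uniq.
have head2 : head x0 (rev (drop i.+1 q)) = x n.
  rewrite -nth0 nth_rev sz2 ?subn_gt0 // nth_drop; congr nth.
  by move: lt_i; clear; lia.
have last1 : last x0 (take i.+1 q) = x i by rewrite -nth_last sz1 nth_take.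
apply: (@cycle_of_path x0).
  by rewrite (sorted_cat x0) s1 s2 head2 last1 h_sym hn !orbT.
have -> : last x0 (take i.+1 q ++ rev (drop i.+1 q)) = x i.+1.
  rewrite last_cat -nth_last size_rev sz2 nth_rev sz2 //.
  rewrite (set_nth_default x0) ?sz2; last by move: lt_i; clear; lia.
  by rewrite nth_drop; congr nth; move: lt_i; clear; lia.
by rewrite -nth0 nth_cat sz1 nth_take // h_sym.
Qed.

(** The witness is the vertex set of a longest path. *)
Lemma small_closed_set u v : h u v ->
  exists K : {set T}, [/\ #|K| <= s.*2,
    exists2 x, x \in K & exists y, h x y &
    forall x y, x \in K -> h x y -> y \in K].
Proof.
move=> huv; have [q [pq maxq]] := ex_longest_path.
have puv : simple_path [:: u; v].
  by rewrite /simple_path /= huv inE !andbT; apply: contraTneq huv => ->; rewrite h_irr.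
have sq1 : 1 < size q by exact: maxq puv.
have [hq uq] := andP pq.
(* Any path on the vertices of [q] is longest, so its first vertex has all its
   neighbours in [q]. This serves for [q], for its reverse, and for a cycle on
   these vertices cut open at an arbitrary vertex. *)
have ext y r : simple_path r -> perm_eq r q -> h y (head u r) -> y \in q.
  move=> /andP[hr ur] rq hy; apply/negPn/negP => yq.
  have hyr : sorted h (y :: r) by case: r hr hy {ur rq} => //= z r -> ->.
  have := maxq (y :: r); rewrite /simple_path cons_uniq hyr ur (perm_mem rq) yq.
  by rewrite /= (perm_size rq) ltnn => /(_ isT).
have [n sq] : exists n, size q = n.+1 by exists (size q).-1; rewrite prednK // ltnW.
pose x := nth u q.
have max0 y : h (x 0) y -> y \in q.
  by rewrite h_sym => hy; apply: (ext y q); rewrite // -nth0.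
have maxn y : h (x n) y -> y \in q.
  rewrite h_sym => hy; apply: (ext y (rev q)); rewrite ?rev_simple_path ?perm_rev //.
  by rewrite -nth0 nth_rev sq // subn1.
have lt_n : n < s.*2.+1.
  rewrite -sq -ltnS ltnNge; apply/negP => lt_q.
  exact: (no_long_path pq (lt_q : s.*2.+1 < size q) max0).
have n_gt0 : 0 < n by move: sq1; rewrite sq ltnS.
have deg0 : s + (x 0 \notin A) <= #|[set z | h (x 0) z]|.
  by apply: (@h_deg _ (x 1)); apply: simple_path_edge.
have degn : s + (x n \notin A) <= #|[set z | h (x n) z]|.
  apply: (@h_deg _ (x n.-1)); rewrite h_sym -{2}(prednK n_gt0).
  by apply: simple_path_edge; rewrite // prednK // sq.
have [r cr rq] : exists2 r, cycle h r & perm_eq r q.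
  apply: (crossing_cycle pq sq max0 maxn).
  apply: leq_trans (leq_add deg0 degn); rewrite addnACA addnn.
  (* When the order is exactly [2s + 1], one more unit is needed; it comes from an
     end outside [A], which exists since the path is not forbidden. *)
  rewrite ltnS leq_eqVlt in lt_n; case/orP: lt_n => [/eqP eqn|lt_n]; last first.
    by rewrite (leq_trans lt_n) // leq_addr.
  have := @noApath u q pq; rewrite sq eqn -/x => /(_ erefl).
  case: (x 0 \in A); case: (x s.*2 \in A) => /=;
  by rewrite ?addn0 ?addn1 ?addn2 // => /(_ isT isT).
have ur : uniq r by rewrite (perm_uniq rq).
exists [set z in q]; split.
- rewrite cardsE (card_uniqP uq) leqNgt; apply/negP => lt_s.
  by apply: (no_long_cycle s_gt0 cr ur); rewrite (perm_size rq).
- exists (x 0); first by rewrite inE mem_nth // sq.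
  by exists (x 1); apply: simple_path_edge.
- move=> y z; rewrite !inE => yq hyz; rewrite -(perm_mem rq) in yq.
  have [i r' eqr] := rot_to yq.
  apply: (ext z (rot i r)); first exact: cycle_simple_path.
  + by rewrite perm_rot.
  + by rewrite eqr h_sym.
Qed.

End Cover.

(** * Counting the adjacent pairs between two sets *)

Section Arcs.
Local Open Scope nat_scope.
Variables (T : finType) (e : rel T).
Hypothesis e_sym : symmetric e.
Hypothesis e_irr : irreflexive e.

(** An edge with both ends in [A :&: B] is counted twice. *)
Definition arcs (A B : {set T}) : nat := \sum_(u in A) \sum_(y in B) e u y.

Lemma arcsC A B : arcs A B = \sum_(y in B) \sum_(u in A) e y u.
Proof.
rewrite /arcs exchange_big; apply: eq_bigr => y _; apply: eq_bigr => u _.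
by rewrite e_sym.
Qed.

Lemma sum_nbrs (B : {set T}) x : \sum_(y in B) e x y = #|[set y in B | e x y]|.
Proof.
rewrite -sum1_card [RHS]big_mkcond [LHS]big_mkcond; apply: eq_bigr => y _.
by rewrite inE; case: (y \in B); case: (e x y).
Qed.

(** A vertex of both [A] and [B] is not adjacent to itself. *)
Lemma arcs_meet A B : arcs A B + #|A :&: B| <= #|A| * #|B|.
Proof.
have -> : #|A :&: B| = \sum_(u in A) (u \in B).
  rewrite -sum1_card [LHS]big_mkcond [RHS]big_mkcond; apply: eq_bigr => y _.
  by rewrite inE; case: (y \in A); case: (y \in B).
rewrite -big_split -sum_nat_const; apply: leq_sum => u _ /=.
have [uB|uB] := boolP (u \in B); last first.
  rewrite addn0 sum_nbrs subset_leq_card //.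
  by apply/subsetP=> y; rewrite inE => /andP[].
rewrite sum_nbrs (cardsD1 u B) uB addnC leq_add2l subset_leq_card //.
apply/subsetP=> y; rewrite !inE => /andP[-> euy]; rewrite andbT.
by apply: contraTneq euy => ->; rewrite e_irr.
Qed.

(** Put [a = #|A|], [b = #|B|]. After [arcs_meet] the claim is
[(a - s) * (b - (s - 1)) <= s * (s - 1) + #|A :&: B|]. It is clear when a factor on
the left is at most zero; otherwise use [a <= 2s], [b <= 2s] and
[a + b <= 2s + #|A :&: B|]. *)
Lemma arcs_small (s : nat) A B : 0 < s -> #|A :|: B| <= s.*2 ->
  arcs A B <= s.-1 * #|A| + s * #|B|.
Proof.
move=> s_gt0 leAB; have := arcs_meet A B; have := cardsUI A B.
have := subset_leq_card (subsetUl A B); have := subset_leq_card (subsetUr A B).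
move: (arcs A B) #|A| #|B| #|A :|: B| #|A :&: B| leAB => m a b n c.
case: s s_gt0 => // s _ /=; clear => le_n le_b le_a eq_n le_m.
have [le_as|lt_sa] := leqP a s.+1; first by nia.
have [le_bs|lt_sb] := leqP b s; first by nia.
have [p eqp] : exists p, a = s.+2 + p by exists (a - s.+2); lia.
have [q eqq] : exists q, b = s.+1 + q by exists (b - s.+1); lia.
have : p * q <= s * s.+1 by apply: leq_mul; lia.
by subst a b; lia.
Qed.

Lemma arcs_closed (K A B : {set T}) :
    (forall x y, x \in K -> x \in A -> y \in B -> e x y -> y \in K) ->
    (forall x y, x \in K -> x \in B -> y \in A -> e x y -> y \in K) ->
  arcs A B = arcs (A :&: K) (B :&: K) + arcs (A :\: K) (B :\: K).
Proof.
move=> clA clB; rewrite /arcs (big_setID K) /=; congr addn; apply: eq_bigr => u.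
- rewrite inE => /andP[uA uK]; rewrite (big_setID K) /= [X in _ + X]big1 ?addn0 // => y.
  rewrite inE => /andP[yK yB]; apply/eqP; rewrite eqb0; apply: contra yK.
  exact: clA.
- rewrite inE => /andP[uK uA]; rewrite (big_setID K) /= [X in X + _]big1 // => y.
  rewrite inE => /andP[yB yK]; apply/eqP; rewrite eqb0; apply: contra uK.
  by rewrite e_sym; apply: clB.
Qed.

(** The extremal case of the theorem, [f] and [g] being the indicator functions of
[A] and [B]; see the introduction. *)
Lemma arcs_bound (s : nat) (U : {set T}) : 0 < s ->
    (forall x p, path_of_order e (2 * s + 1) x p ->
       x \in U -> last x p \in U -> False) ->
  forall A B : {set T}, A \subset U -> arcs A B <= s.-1 * #|A| + s * #|B|.
Proof.
move=> s_gt0 noUpath A B.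
have [n] := ubnP (#|A| + #|B|); elim: n A B => // n IHn A B le_n subAU.
have [/existsP[a /andP[aA lt_a]]|/existsPn degA] :=
    boolP [exists a, (a \in A) && (\sum_(y in B) e a y < s)].
  have cA : #|A| = #|A :\ a|.+1 by rewrite (cardsD1 a A) aA.
  rewrite cA in le_n.
  have := IHn (A :\ a) B le_n (subset_trans (subsetDl _ _) subAU).
  rewrite cA mulnS /arcs (big_setD1 a aA) -addnA => IH.
  by apply: leq_add => //; rewrite -ltnS prednK.
have [/existsP[b /andP[bB le_b]]|/existsPn degB] :=
    boolP [exists b, (b \in B) && (\sum_(u in A) e b u <= s)].
  have cB : #|B| = #|B :\ b|.+1 by rewrite (cardsD1 b B) bB.
  rewrite cB addnS in le_n.
  have := IHn A (B :\ b) le_n subAU.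
  rewrite cB mulnS addnCA !arcsC (big_setD1 b bB) => IH.
  exact: leq_add.
pose h x y := e x y && ((x \in A) && (y \in B) || (x \in B) && (y \in A)).
have [/existsP[u /existsP[v huv]]|/existsPn noh] := boolP [exists u, [exists v, h u v]];
    last first.
  rewrite /arcs big1 // => u uA; rewrite big1 // => v vB; apply/eqP; rewrite eqb0.
  by have /existsPn/(_ v) := noh u; rewrite /h uA vB /= andbT.
have h_sym : symmetric h by move=> x y; rewrite /h e_sym orbC ![(_ \in B) && _]andbC.
have h_irr : irreflexive h by move=> x; rewrite /h e_irr.
have h_cover x y : h x y -> (x \in A) || (y \in A).
  by case/andP=> _ /orP[/andP[-> _]|/andP[_ ->]]; rewrite ?orbT.
have noApath x0 q : simple_path h q -> size q = s.*2.+1 ->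
    nth x0 q 0 \in A -> nth x0 q s.*2 \in A -> False.
  case: q => //= x p /andP[hp up] [sp] xA lA; apply: (noUpath x p).
  - rewrite /path_of_order up /= sp mul2n addn1 eqxx !andbT.
    by apply: sub_path hp => y z /andP[].
  - exact: (subsetP subAU).
  - by apply: (subsetP subAU); move: lA; rewrite -sp (last_nth x0).
(* A non-isolated vertex outside [A] lies in [B]; that is where the larger bound
   of the second deletion step is available. *)
have h_deg x y : h x y -> s + (x \notin A) <= #|[set z | h x z]|.
  case/andP=> _ hxy; have [xA|xA] := boolP (x \in A).
    rewrite addn0; have := degA x; rewrite xA /= -leqNgt sum_nbrs => /leq_trans-> //.
    by apply/subset_leq_card/subsetP => z; rewrite !inE /h xA => /andP[-> ->].
  rewrite (negbTE xA) /= in hxy; case/andP: hxy => xB _.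
  rewrite addn1; have := degB x; rewrite xB /= -ltnNge sum_nbrs => /leq_trans-> //.
  apply/subset_leq_card/subsetP => z.
  by rewrite !inE /h xB => /andP[-> ->]; rewrite orbT.
have [K [leK [w wK [w' hw]] clK]] :=
  small_closed_set h_sym h_irr h_cover noApath s_gt0 h_deg huv.
rewrite (@arcs_closed K); first last.
- by move=> x y xK xB yA exy; apply: clK xK _; rewrite /h exy xB yA orbT.
- by move=> x y xK xA yB exy; apply: clK xK _; rewrite /h exy xA yB.
rewrite -(cardsID K A) -(cardsID K B) !mulnDr addnACA; apply: leq_add.
  apply: arcs_small => //; rewrite -setIUl; apply: leq_trans leK.
  exact/subset_leq_card/subsetIr.
apply: IHn; last exact: subset_trans (subsetDl _ _) subAU.
rewrite ltnS in le_n; apply: leq_trans le_n.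
rewrite -(cardsID K A) -(cardsID K B) addnACA -[X in X < _]add0n ltn_add2r.
have [wA|wB] : w \in A \/ w \in B by case/andP: hw => _ /orP[] /andP[]; [left|right].
- by apply: ltn_addr; apply/card_gt0P; exists w; rewrite inE wA.
- by apply: ltn_addl; apply/card_gt0P; exists w; rewrite inE wB.
Qed.
End Arcs.

(** * From sets to weights *)

Local Open Scope ring_scope.

(** Keeping only the terms with [0 < c u] and replacing [f u] by its maximum can only
increase the sum, and the hypothesis bounds what is left. *)
Lemma sum_le_supnorm (R : realFieldType) (T : finType) (U : {set T})
    (f c : T -> R) (D : R) :
  (forall u, u \in U -> 0 <= f u) ->
  (forall A : {set T}, A \subset U -> \sum_(u in A) c u <= D) ->
  \sum_(u in U) f u * c u <= supnorm U f * D.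
Proof.
move=> f_ge0 leD; pose A := [set u in U | 0 < c u].
have sub : A \subset U by apply/subsetP => u; rewrite inE => /andP[].
apply: le_trans (_ : \sum_(u in A) supnorm U f * c u <= _); last first.
  by rewrite -mulr_sumr ler_wpM2l ?leD //; apply: bigmax_ge_id.
rewrite [leRHS]big_mkcond [leLHS]big_mkcond; apply: ler_sum => u _.
rewrite inE; have [uU|] := boolP (u \in U); last by [].
have [c_gt0|c_le0] /= := ltP 0 (c u).
  by rewrite ler_pM2r //; apply: le_bigmax_cond.
by rewrite mulr_ge0_le0 ?f_ge0.
Qed.

Theorem lemma2p13 (R : realFieldType) (s : nat) (T : finType) (e : rel T)
    (U : {set T}) (f g : T -> R)
    (s_ge1 : (1 <= s)%N)
    (e_sym : symmetric e) (e_irr : irreflexive e)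
    (noUpath : ~ exists x : T, exists p : seq T,
        [/\ path_of_order e (2 * s + 1)%N x p, x \in U & last x p \in U])
    (f_ge0 : forall u : T, u \in U -> 0 <= f u)
    (g_ge0 : forall y : T, 0 <= g y) :
  \sum_(u in U) f u * (\sum_(y | e y u) g y)
    <= (s%:R - 1) * supnorm [set: T] g * (\sum_(u in U) f u)
       + s%:R * supnorm U f * (\sum_(y : T) g y).
Proof.
have noUp x p : path_of_order e (2 * s + 1) x p -> x \in U -> last x p \in U -> False.
  by move=> px xU lU; apply: noUpath; exists x, p.
(* Isolate the sum over [f]; its coefficients are [deg_g u - (s - 1) * |g|]. *)
rewrite -lerBlDl mulr_sumr -sumrB.
under eq_bigr => u _ do rewrite [_ * f u]mulrC -mulrBr.
rewrite [X in _ <= X * _]mulrC -mulrA; apply: sum_le_supnorm => // A subAU.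
rewrite sumrB sumr_const.
(* For a fixed [A], the same inequality read as a sum over [g], with coefficients
   [deg_A y - s]. *)
have -> : \sum_(u in A) \sum_(y | e y u) g y =
    \sum_(y : T) g y * (\sum_(u in A) e u y)%:R.
  under eq_bigr do rewrite big_mkcond; rewrite exchange_big; apply: eq_bigr => y _ /=.
  rewrite natr_sum mulr_sumr; apply: eq_bigr => u _.
  by rewrite e_sym; case: (e u y); rewrite ?mulr1 ?mulr0.
rewrite lerBlDl -lerBlDr mulr_sumr -sumrB.
under eq_bigr => y _ do rewrite [s%:R * g y]mulrC -mulrBr.
rewrite (eq_bigl (mem [set: T]) _ (fun y => esym (in_setT y))).
rewrite -[leRHS]mulr_natr -mulrA mulrCA; apply: sum_le_supnorm => // B _.
rewrite sumrB sumr_const -natr_sum lerBlDr -mulrnA.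
have -> : s%:R - 1 = s.-1%:R :> R by rewrite -subn1 natrB.
rewrite -natrM -natrD ler_nat.
by move: (arcs_bound e_sym e_irr s_ge1 noUp B subAU); rewrite /arcs exchange_big.
Qed.
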